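(* For any finite simple graph $G$ with no isolated vertex, $$\gamma_{\times 2}(G)\leq \gamma_2(G)+\gamma(G),$$ where $\gamma_{\times 2}(G)$ is the double domination number, $\gamma_2(G)$ the $2$-domination number and $\gamma(G)$ the domination number of $G$.
   Context: Graphs are finite and simple. For a vertex $v\in V(G)$, the open neighbourhood is $N(v)=\{u\in V(G): u \text{ is adjacent to } v\}$ and the closed neighbourhood is $N[v]=N(v)\cup\{v\}$. A set $D\subseteq V(G)$ is a dominating set if $|D\cap N[v]|\ge 1$ for every $v\in V(G)$; the domination number $\gamma(G)$ is the minimum cardinality of a dominating set. A set $D\subseteq V(G)$ is a double dominating set (2-tuple dominating set) if $|D\cap N[v]|\ge 2$ for every $v\in V(G)$ (including the vertices of $D$); the double domination number $\gamma_{\times 2}(G)$ is the minimum cardinality of a double dominating set. A set $D\subseteq V(G)$ is a $2$-dominating set if $|D\cap N(v)|\ge 2$ for every $v\in V(G)\setminus D$; the $2$-domination number $\gamma_2(G)$ is the minimum cardinality of a $2$-dominating set. *)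

(* Defs.v *)
From mathcomp Require Import all_boot.

Set Implicit Arguments.
Unset Strict Implicit.
Unset Printing Implicit Defensive.

(* A finite simple graph is a finType V of vertices with a
   symmetric and irreflexive adjacency relation e : rel V. *)

Definition open_nbhd (V : finType) (e : rel V) (v : V) : {set V} :=
  [set u | e v u].

Definition closed_nbhd (V : finType) (e : rel V) (v : V) : {set V} :=
  v |: open_nbhd e v.

Definition no_isolated (V : finType) (e : rel V) : Prop :=
  forall v : V, open_nbhd e v != set0.

Definition dominating (V : finType) (e : rel V) (D : {set V}) : bool :=
  [forall v, 1 <= #|D :&: closed_nbhd e v|].

Definition double_dominating (V : finType) (e : rel V) (D : {set V}) : bool :=
  [forall v, 2 <= #|D :&: closed_nbhd e v|].

Definition two_dominating (V : finType) (e : rel V) (D : {set V}) : bool :=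
  [forall v in ~: D, 2 <= #|D :&: open_nbhd e v|].

(* Minimum cardinality of a set satisfying P.  It is meaningful when P holds of
   the whole vertex set: this is always so for dominating and two_dominating,
   and holds for double_dominating when there is no isolated vertex (see the
   lemmas below).  When P setT fails the value is a don't-care. *)
Definition min_card (V : finType) (P : pred {set V}) : nat :=
  #|[arg min_(D < [set: V] | P D) #|D|]|.

Definition domination_number (V : finType) (e : rel V) : nat :=
  min_card (dominating e).

Definition double_domination_number (V : finType) (e : rel V) : nat :=
  min_card (double_dominating e).

Definition two_domination_number (V : finType) (e : rel V) : nat :=
  min_card (two_dominating e).

Lemma min_cardP (V : finType) (P : pred {set V}) :
  P [set: V] ->
  (exists2 D, P D & #|D| = min_card P) /\ (forall D, P D -> min_card P <= #|D|).
Proof.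
by rewrite /min_card => PT; case: arg_minnP => // D PD minD; split; first exists D.
Qed.

Lemma dominating_setT (V : finType) (e : rel V) : dominating e [set: V].
Proof.
by apply/forallP => v; rewrite setTI card_gt0; apply/set0Pn; exists v; rewrite setU11.
Qed.

Lemma two_dominating_setT (V : finType) (e : rel V) : two_dominating e [set: V].
Proof. by apply/forall_inP => v; rewrite !inE. Qed.

Lemma double_dominating_setT (V : finType) (e : rel V) :
  irreflexive e -> no_isolated e -> double_dominating e [set: V].
Proof.
move=> e_irr e_iso; apply/forallP => v.
by rewrite setTI cardsU1 inE e_irr add1n ltnS card_gt0 e_iso.
Qed.

(* Main.v *)
Require Import Defs.
From mathcomp Require Import all_boot.

(** Let [D] be a 2-dominating set and [S] a dominating set. A vertex outside
    [D] already has two neighbours in [D]. A vertex of [D] is its own first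
    dominator, so all it lacks is a neighbour in the set being built: if it is
    not in [S], then [S] must dominate it through a neighbour; if it is in
    [D :&: S], one of its neighbours is added by hand. The result has at most
    [#|D :|: S| + #|D :&: S| = #|D| + #|S|] vertices. *)

(** Irreflexivity makes [v] and [u] distinct. This is how every vertex of [D]
    gets dominated twice: once by itself and once by a neighbour. *)
Lemma mem_adj_closed_nbhd_ge2 (V : finType) (e : rel V) (W : {set V}) (v u : V) :
  irreflexive e -> v \in W -> u \in W -> e v u ->
  2 <= #|W :&: closed_nbhd e v|.
Proof.
move=> e_irr vW uW evu.
have neq_vu : v != u by apply: contraTneq evu => <-; rewrite e_irr.
have <- : #|[set v; u]| = 2 by rewrite cards2 neq_vu.
apply/subset_leq_card/subsetP => x; rewrite !inE.
by case/orP=> /eqP ->; rewrite ?vW ?uW ?evu ?eqxx ?orbT.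
Qed.

Lemma no_isolated_neighbour (V : finType) (e : rel V) :
  no_isolated e -> exists f : V -> V, forall v, e v (f v).
Proof.
move=> e_iso; exists (fun v => odflt v [pick u | e v u]) => v.
case: pickP => [//|no_u]; have /set0Pn[u] := e_iso v.
by rewrite inE no_u.
Qed.

(** Only [D :&: S] receives extra neighbours, since [S] serves [D :\: S]; as
    [D :|: S] also counts [D :&: S] once only, the extra cost is exactly paid
    for by the overlap. *)
Lemma double_dominating_extension (V : finType) (e : rel V) (f : V -> V)
    (D S : {set V}) :
  irreflexive e -> (forall v, e v (f v)) ->
  two_dominating e D -> dominating e S ->
  double_dominating e (D :|: S :|: f @: (D :&: S)).
Proof.
move=> e_irr ef /forall_inP domD /forallP domS; apply/forallP => v.
have [vD | vND] := boolP (v \in D); last first.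
  apply: (leq_trans (domD v _)); first by rewrite inE.
  by apply/subset_leq_card/setISS; rewrite ?subsetUr // -setUA subsetUl.
have [vS | vNS] := boolP (v \in S).
  apply: (@mem_adj_closed_nbhd_ge2 _ _ _ _ (f v)) => //; first by rewrite !inE vD.
  by rewrite inE imset_f ?orbT // inE vD.
have := domS v; rewrite card_gt0 => /set0Pn[u]; rewrite !inE.
case/andP=> uS /orP[/eqP eq_uv | evu]; first by rewrite -eq_uv uS in vNS.
by apply: (@mem_adj_closed_nbhd_ge2 _ _ _ _ u) => //; rewrite !inE ?vD ?uS ?orbT.
Qed.

Theorem theorem2p8 (V : finType) (e : rel V)
    (e_sym : symmetric e) (e_irr : irreflexive e) (e_iso : no_isolated e) :
  double_domination_number e <= two_domination_number e + domination_number e.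
Proof.
rewrite /two_domination_number /domination_number.
have [[D domD <-] _] := min_cardP (two_dominating_setT e).
have [[S domS <-] _] := min_cardP (dominating_setT e).
have [_ min_dd] := min_cardP (double_dominating_setT e_irr e_iso).
have [f ef] := no_isolated_neighbour _ _ e_iso.
apply: leq_trans (min_dd _ (double_dominating_extension _ _ _ _ _ e_irr ef domD domS)) _.
rewrite -cardsUI; apply: leq_trans (leq_card_setU _ _) _.
by rewrite leq_add2l leq_imset_card.
Qed.
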